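(* (i) The map $\mathrm{ev}:\mathbb C^\flat\to\mathcal T\mathbb C$ defined by $$\mathrm{ev}(\epsilon\,e(z)):=\epsilon\,e^z\quad(\epsilon\in\{\pm1\},\ z\in\mathbb C),\qquad \mathrm{ev}(0)=0,$$ is a homomorphism of hyperfields. Moreover one has $\mathrm{ev}(x)=x^{(0)}$ for all $x\in\mathbb C^\flat$, where $(x^{(j)})_{j\in\mathbb Z}$ is the sequence of complex numbers associated to $x$. (ii) The hyperfield homomorphism $\mathrm{ev}$ is surjective, and at the level of the multiplicative groups one has the exact sequence $$1\to(-e(i\pi))^{\mathbb Z}\to(\mathbb C^\flat)^\times\xrightarrow{\ \mathrm{ev}\ }\mathbb C^\times\to1.$$
   Context: A homomorphism of hyperfields is a map $f$ with $f(0)=0$, $f(1)=1$, $f(xy)=f(x)f(y)$ and $f(x+y)\subset f(x)+f(y)$ (additions being multivalued). The hyperfield $\mathbb C^\flat$: let $\mathbb C_+=\{z\in\mathbb C\mid\Re(z)\ge0\text{ and }\Im(z)\ge0\text{ if }\Re(z)=0\}$ and write $z\le z'$ when $z'-z\in\mathbb C_+$ (a total order on $\mathbb C$ compatible with addition). As a set $\mathbb C^\flat=(\mathbb C\coprod\mathbb C)\cup\{0\}$, nonzero elements being written uniquely $\epsilon\,e(z)$, $\epsilon=\pm1$, $z\in\mathbb C$ (with $e(z)$ a formal symbol). The multiplication is $\epsilon e(z)\cdot\epsilon'e(z')=\epsilon\epsilon'e(z+z')$, and the hyperaddition (with $0$ neutral) is: $\epsilon e(z)+\epsilon'e(z')$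 equals $\epsilon e(z)$ if $z'<z$; $\epsilon'e(z')$ if $z<z'$; $\epsilon e(z)$ if $z=z'$ and $\epsilon=\epsilon'$; and $\{0\}\cup\{\epsilon''e(z'')\mid\epsilon''=\pm1,\ z''\le z\}$ if $z=z'$ and $\epsilon=-\epsilon'$. The sequence $(x^{(j)})_{j\in\mathbb Z}$ associated to $x=\epsilon e(z)$ is $x^{(j)}=\epsilon e^{3^jz}$, and to $x=0$ it is $x^{(j)}=0$. The hyperfield $\mathcal T\mathbb C$ of Viro tropical complex numbers: the set $\mathbb C$ with its usual multiplication and the hyperaddition: if $|a|<|b|$, $a\smile b=b$; if $|a|>|b|$, $a\smile b=a$; if $|a|=|b|$ and $a\ne-b$, with $a=re^{i\alpha}$, $b=re^{i\beta}$, $|\alpha-\beta|<\pi$, then $a\smile b=\{re^{i\varphi}\mid|\alpha-\varphi|+|\varphi-\beta|=|\alpha-\beta|\}$; if $a+b=0$, $a\smile b=\{c\in\mathbb C\mid|c|\le|a|\}$. *)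

(* Defs.v *)
From HB Require Import structures.
From mathcomp Require Import all_boot all_order all_algebra.
From mathcomp Require Import complex.
From mathcomp Require Import boolp classical_sets reals sequences exp trigo.
From mathcomp Require Import ring.

Set Implicit Arguments.
Unset Strict Implicit.
Unset Printing Implicit Defensive.

Import Order.TTheory GRing.Theory Num.Theory.

Local Open Scope classical_set_scope.
Local Open Scope ring_scope.
Local Open Scope complex_scope.

(* The operations of a hyperfield, without its axioms: a homomorphism is
   defined in terms of the operations alone. *)
Record hyperfield_ops := HyperfieldOps {
  hsort :> Type ;
  hzero : hsort ;
  hone : hsort ;
  hmul : hsort -> hsort -> hsort ;
  hadd : hsort -> hsort -> set hsort }.

Arguments hzero {h}.
Arguments hone {h}.

Definition hyperfield_hom (H K : hyperfield_ops) (f : H -> K) : Prop :=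
  [/\ f hzero = hzero,
      f hone = hone,
      forall x y, f (hmul x y) = hmul (f x) (f y) &
      forall x y, f @` hadd x y `<=` hadd (f x) (f y)].

Section ComplexExponential.
Variable R : realType.

Definition cexp (z : R[i]) : R[i] :=
  (expR (complex.Re z))%:C * (cos (complex.Im z) +i* sin (complex.Im z)).

Lemma cexpD (z w : R[i]) : cexp (z + w) = cexp z * cexp w.
Proof.
case: z w => [a b] [c d]; rewrite /cexp /= expRD cosD sinD.
by apply/eqP; rewrite eq_complex /=; apply/andP; split; apply/eqP; ring.
Qed.

Lemma cexp0 : cexp 0 = 1.
Proof.
by rewrite /cexp /= expR0 cos0 sin0 mul1r.
Qed.

Lemma cexp_neq0 (z : R[i]) : cexp z != 0.
Proof.
apply/eqP => z0; have /eqP := cexpD z (- z).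
by rewrite subrr cexp0 z0 mul0r oner_eq0.
Qed.

End ComplexExponential.

Section Cflat.
Variable R : realType.

Definition Cplus (z : R[i]) : bool :=
  (0 <= complex.Re z) && ((complex.Re z == 0) ==> (0 <= complex.Im z)).

Definition cle (z w : R[i]) : bool := Cplus (w - z).
Definition clt (z w : R[i]) : bool := (z != w) && cle z w.

(* [None] is 0 and [Some (s, z)] is (-1)^s e(z). *)
Definition Cflat : Type := option (bool * R[i]).
HB.instance Definition _ := Choice.on Cflat.

Definition Cflat0 : Cflat := None.
Definition signed_e (s : bool) (z : R[i]) : Cflat := Some (s, z).

Definition Cflat_mul (x y : Cflat) : Cflat :=
  match x, y with
  | Some (s, z), Some (t, w) => signed_e (s (+) t) (z + w)
  | _, _ => Cflat0
  end.

Definition Cflat_add (x y : Cflat) : set Cflat :=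
  match x, y with
  | None, _ => [set y]
  | _, None => [set x]
  | Some (s, z), Some (t, w) =>
      if clt w z then [set x]
      else if clt z w then [set y]
      else if s == t then [set x]
      else Cflat0 |` [set v | exists t' z', v = signed_e t' z' /\ cle z' z]
  end.

Definition Cflat_ops : hyperfield_ops :=
  HyperfieldOps Cflat0 (signed_e false 0) Cflat_mul Cflat_add.

Definition Cflat_seq (x : Cflat) (j : int) : R[i] :=
  if x is Some (s, z) then (-1) ^+ s * cexp ((3 : R[i]) ^ j * z) else 0.

Definition ev (x : Cflat) : R[i] :=
  if x is Some (s, z) then (-1) ^+ s * cexp z else 0.

End Cflat.

Arguments Cflat0 {R}.

Section Viro.
Variable R : realType.

(* The norm of [R[i]] takes its (real) values in [R[i]]. In the third case the
   arguments [alpha] and [beta] of [a] and [b] are unique up to a common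
   multiple of 2 pi, so the arc does not depend on their choice. *)
Definition viro_add (a b : R[i]) : set R[i] := [set c |
  [\/ `|a| < `|b| /\ c = b,
      `|b| < `|a| /\ c = a,
      [/\ `|a| = `|b|, a != - b &
          exists alpha beta phi : R,
            [/\ a = `|a| * cexp (0 +i* alpha),
                b = `|a| * cexp (0 +i* beta),
                `|alpha - beta| < pi,
                `|alpha - phi| + `|phi - beta| = `|alpha - beta| &
                c = `|a| * cexp (0 +i* phi)]] |
      a + b = 0 /\ `|c| <= `|a|]].

Definition TC_ops : hyperfield_ops :=
  HyperfieldOps (0 : R[i]) 1 *%R viro_add.

End Viro.

Section MultiplicativeGroups.
Variable R : realType.

Definition Cunits : Type := {x : R[i] | x != 0}.
HB.instance Definition _ := Choice.on Cunits.

Definition Cunits_mul (x y : Cunits) : Cunits :=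
  exist _ (val x * val y) (mulf_neq0 (valP x) (valP y)).
Definition Cunits_one : Cunits := exist _ 1 (oner_neq0 _).
Definition Cunits_inv (x : Cunits) : Cunits :=
  exist _ (val x)^-1 (invr_neq0 (valP x)).

Fact Cunits_mulA : associative Cunits_mul.
Proof. by move=> x y z; apply/val_inj; rewrite /= mulrA. Qed.
Fact Cunits_mul1x : left_id Cunits_one Cunits_mul.
Proof. by move=> x; apply/val_inj; rewrite /= mul1r. Qed.
Fact Cunits_mulx1 : right_id Cunits_one Cunits_mul.
Proof. by move=> x; apply/val_inj; rewrite /= mulr1. Qed.
Fact Cunits_mulV : left_inverse Cunits_one Cunits_inv Cunits_mul.
Proof. by move=> x; apply/val_inj; rewrite /= mulVf// (valP x). Qed.
Fact Cunits_Vmul : right_inverse Cunits_one Cunits_inv Cunits_mul.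
Proof. by move=> x; apply/val_inj; rewrite /= mulfV// (valP x). Qed.

HB.instance Definition _ := isGroup.Build Cunits
  Cunits_mulA Cunits_mul1x Cunits_mulx1 Cunits_mulV Cunits_Vmul.

Definition Cflat_units : Type := {x : Cflat R | x != Cflat0}.
HB.instance Definition _ := Choice.on Cflat_units.

Definition Cflat_inv (x : Cflat R) : Cflat R :=
  if x is Some (s, z) then signed_e s (- z) else Cflat0.

Fact Cflat_mul_neq0 (x y : Cflat R) :
  x != Cflat0 -> y != Cflat0 -> Cflat_mul x y != Cflat0.
Proof. by case: x y => [[s z]|//] [[t w]|]. Qed.
Fact Cflat_inv_neq0 (x : Cflat R) : x != Cflat0 -> Cflat_inv x != Cflat0.
Proof. by case: x => [[s z]|]. Qed.

Definition Cflat_units_mul (x y : Cflat_units) : Cflat_units :=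
  exist _ (Cflat_mul (val x) (val y)) (Cflat_mul_neq0 (valP x) (valP y)).
Definition unit_e (s : bool) (z : R[i]) : Cflat_units :=
  exist _ (signed_e s z) isT.
Definition Cflat_units_inv (x : Cflat_units) : Cflat_units :=
  exist _ (Cflat_inv (val x)) (Cflat_inv_neq0 (valP x)).

Fact Cflat_units_mulA : associative Cflat_units_mul.
Proof.
move=> [[[s x]|//] ?] [[[t y]|//] ?] [[[u z]|//] ?]; apply/val_inj => /=.
by rewrite addbA addrA.
Qed.
Fact Cflat_units_mul1x : left_id (unit_e false 0) Cflat_units_mul.
Proof. by move=> [[[s x]|//] ?]; apply/val_inj; rewrite /= add0r. Qed.
Fact Cflat_units_mulx1 : right_id (unit_e false 0) Cflat_units_mul.
Proof. by move=> [[[s x]|//] ?]; apply/val_inj; rewrite /= addr0 addbF. Qed.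
Fact Cflat_units_mulV :
  left_inverse (unit_e false 0) Cflat_units_inv Cflat_units_mul.
Proof. by move=> [[[s x]|//] ?]; apply/val_inj; rewrite /= addNr addbb. Qed.
Fact Cflat_units_Vmul :
  right_inverse (unit_e false 0) Cflat_units_inv Cflat_units_mul.
Proof. by move=> [[[s x]|//] ?]; apply/val_inj; rewrite /= subrr addbb. Qed.

HB.instance Definition _ := isGroup.Build Cflat_units
  Cflat_units_mulA Cflat_units_mul1x Cflat_units_mulx1
  Cflat_units_mulV Cflat_units_Vmul.

Fact ev_neq0 (x : Cflat R) : x != Cflat0 -> ev x != 0.
Proof.
by case: x => [[s z] _|//]; rewrite mulf_neq0 ?cexp_neq0// signr_eq0.
Qed.

Definition ev_units (x : Cflat_units) : Cunits :=
  exist _ (ev (val x)) (ev_neq0 (valP x)).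

End MultiplicativeGroups.

Section Powers.
Local Open Scope group_scope.
Variables (G : groupType) (g : G).

Definition zpow (n : int) : G :=
  match n with Posz k => g ^+ k | Negz k => g ^- k.+1 end.

Definition powers : pred G := fun x => `[< exists n : int, x = zpow n >].

Fact powersP (x : G) :
  reflect (exists k l : nat, x = g ^+ k / g ^+ l) (x \in powers).
Proof.
apply: (iffP idP) => [/asboolP[[k|k] ->] | [k [l ->]]].
- by exists k, 0%N; rewrite expg0 invg1 mulg1.
- by exists 0%N, k.+1; rewrite expg0 mul1g.
apply/asboolP; have [lk|kl] := leqP l k.
  by exists (Posz (k - l)); rewrite /= -{1}(subnK lk) expgnDr mulgK.
exists (Negz (l - k).-1); rewrite /= prednK ?subn_gt0//.
by rewrite -{1}(subnK (ltnW kl)) expgnDr invgM mulVKg.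
Qed.

Fact powers_group_closed : group_closed powers.
Proof.
split; first by apply/powersP; exists 0%N, 0%N; rewrite expg0 mulgV.
move=> _ _ /powersP[k [l ->]] /powersP[m [n ->]].
apply/powersP; exists (k + n)%N, (m + l)%N.
have c (i j : nat) : commute (g ^+ i) (g ^+ j) by apply: commuteX2.
rewrite invgM invgK !expgnDr invgM !mulgA; congr (_ * _).
by rewrite -!mulgA; congr (_ * _); exact/commute_sym/commuteV/c.
Qed.

Definition powers_group : Type := {x : G | x \in powers}.
HB.instance Definition _ := SubChoice.on powers_group.
HB.instance Definition _ := SubChoice_isSubGroup.Build G powers powers_group
  powers_group_closed.

End Powers.

Section ShortExact.
Local Open Scope group_scope.

Definition short_exact (A B C : groupType) (f : A -> B) (g : B -> C) : Prop :=
  [/\ {morph f : x y / x * y} /\ {morph g : x y / x * y},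
      injective f,
      range f = [set b | g b = 1] &
      range g = [set: C]].

End ShortExact.

(* Main.v *)
Require Import Defs.
From HB Require Import structures.
From mathcomp Require Import all_boot all_order all_algebra.
From mathcomp Require Import complex.
From mathcomp Require Import boolp classical_sets reals sequences exp trigo.
From mathcomp Require Import ring lra.

(** The modulus of [ev (s e(z))] is [exp (Re z)], and the total order on C compares
real parts first; so [ev] is monotone from that order to moduli, although not
strictly so. Weak monotonicity suffices for hyperadditions. If the sum in the
flat hyperfield is a single summand [x], then [y] is not larger than [x],
hence [|ev y| <= |ev x|], and a tropical sum always contains the summand of
largest modulus ([viro_add_maxl]): in the delicate case of equal moduli it is
an endpoint of the arc, or a point of the disc. If the sum is multivalued, then
the summands are opposite, so are their images, and the images of all
elements that are not larger lie in the disc ([ev_add]).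

Surjectivity is the polar form of a complex number. For the kernel, write g for
[- e(i pi)], which [ev] sends to 1. Dividing an element of the kernel
by a power of g brings its imaginary part into [0, pi), and on that strip
[ev = 1] forces the real part to vanish (modulus), then the imaginary part
(its sine is zero), and finally the sign to be +1 ([ker_ev_units_strip]). So
every element of the kernel is the power of g given by a floor
([ker_ev_units]). *)

Set Implicit Arguments.
Unset Strict Implicit.

Import Order.TTheory GRing.Theory Num.Theory.

Local Open Scope classical_set_scope.
Local Open Scope ring_scope.
Local Open Scope complex_scope.

(** * Modulus and multiplicativity of the evaluation *)

Lemma norm_cexp (R : realType) (z : R[i]) :
  `|cexp z| = (expR (complex.Re z))%:C.
Proof.
rewrite /cexp normrM !normc_def /= cos2Dsin2 sqrtr1 mulr1.
by rewrite expr0n /= addr0 sqrtr_sqr ger0_norm ?expR_ge0.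
Qed.

Lemma norm_ev_signed_e (R : realType) (s : bool) (z : R[i]) :
  `|ev (signed_e s z)| = (expR (complex.Re z))%:C.
Proof. by rewrite /= normrM normr_sign mul1r norm_cexp. Qed.

Lemma norm_ev_le (R : realType) (s t : bool) (z w : R[i]) :
  cle z w -> `|ev (signed_e s z)| <= `|ev (signed_e t w)|.
Proof.
case: z w => [a b] [c d] /andP[/= + _]; rewrite subr_ge0 => ac.
by rewrite !norm_ev_signed_e lecR ler_expR.
Qed.

Lemma ev_mul (R : realType) (x y : Cflat R) :
  ev (Cflat_mul x y) = ev x * ev y.
Proof.
case: x y => [[s z]|] [[t w]|] /=; rewrite ?(mul0r, mulr0)//.
by rewrite cexpD signr_addb mulrACA.
Qed.

(** * Arguments of complex numbers *)

(** The argument is the arc cosine of the abscissa, with the sign of the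
    ordinate. The interval is open at - pi so that an argument of a point other
    than -1 has absolute value less than pi, as an arc requires. *)
Lemma unit_circle_arg (R : realType) (x y : R) : x ^+ 2 + y ^+ 2 = 1 ->
  exists t : R, [/\ - pi < t <= pi, x = cos t & y = sin t].
Proof.
move=> xy1.
have x1 : -1 <= x <= 1.
  by apply/andP; split; nra.
have cosx : cos (acos x) = x by apply: acosK; rewrite in_itv.
have sinx : sin (acos x) = `|y|.
  by rewrite sin_acos// -xy1 addrC addKr sqrtr_sqr.
have := acos_ge0 x1; have := acos_lepi x1; have := @pi_gt0 R => pi0 xpi x0.
have [y0|y0] := leP 0 y.
  exists (acos x); split=> //; last by rewrite sinx ger0_norm.
  by rewrite xpi (lt_le_trans _ x0)// oppr_lt0.
exists (- acos x); rewrite cosN sinN cosx sinx ltr0_norm// opprK; split=> //.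
rewrite ltrN2 (le_trans _ (ltW pi0)) ?oppr_le0// andbT lt_neqAle xpi andbT.
(* The value pi is excluded because sin pi = 0 while y < 0. *)
apply/eqP => xE; move: sinx; rewrite xE sinpi => /esym/normr0P/eqP yE.
by rewrite yE ltxx in y0.
Qed.

Lemma polar_form (R : realType) (z : R[i]) : z != 0 ->
  exists t : R, - pi < t <= pi /\ z = `|z| * cexp (0 +i* t).
Proof.
case: z => a b z0; rewrite normc_def /=.
set r := Num.sqrt _.
have r2 : r ^+ 2 = a ^+ 2 + b ^+ 2 by rewrite sqr_sqrtr// addr_ge0 ?sqr_ge0.
have r0 : r != 0.
  apply: contra z0 => /eqP r0; move/eqP: r2.
  rewrite r0 expr0n eq_sym paddr_eq0 ?sqr_ge0// !sqrf_eq0.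
  by rewrite eq_complex.
have [|t [tpi at_ bt]] := @unit_circle_arg R (a / r) (b / r).
  by rewrite !expr_div_n -mulrDl -r2 mulfV// sqrf_eq0.
exists t; split=> //; rewrite /cexp /= expR0 -at_ -bt.
by apply/eqP; rewrite eq_complex /=; apply/andP; split; apply/eqP; field.
Qed.

(** * Compatibility with the hyperadditions *)

(** For equal moduli and [a <> - b], the quotient [b / a] is on the unit circle
    and is not -1, so its argument lies strictly between - pi and pi: adding it to
    an argument of [a] gives an arc from [a] to [b], of which [a] is an end. *)
Lemma viro_add_maxl (R : realType) (a b : R[i]) :
  `|b| <= `|a| -> viro_add a b a.
Proof.
rewrite le_eqVlt => /predU1P[nab|ba]; last by apply: Or42.
have [->|ab] := eqVneq a (- b).
  by apply: Or44; rewrite addNr.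
have a0 : a != 0.
  apply: contra ab => /eqP a0; move: nab; rewrite a0 normr0 => /normr0P/eqP ->.
  by rewrite oppr0.
have b0 : b != 0 by rewrite -normr_eq0 nab normr_eq0.
have [al [_ aE]] := polar_form a0.
have [th [thpi baE]] := polar_form (mulf_neq0 b0 (invr_neq0 a0)).
have nba : `|b / a| = 1 by rewrite normf_div nab divff// normr_eq0.
have bE : b = `|a| * cexp (0 +i* (al + th)).
  have -> : 0 +i* (al + th) = 0 +i* al + 0 +i* th :> R[i].
    by apply/eqP; rewrite eq_complex /= addr0 !eqxx.
  by rewrite cexpD mulrA -aE -[cexp _]mul1r -nba -baE mulrC divfK.
apply: Or43; split=> //.
exists al, (al + th), al; split=> //; last by rewrite subrr normr0 add0r.
rewrite opprD addNKr normrN lter_norml.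
move/andP: thpi => [-> /=]; rewrite le_eqVlt => /predU1P[thE|//].
case/eqP: ab; rewrite -[b](divfK a0) baE nba thE /cexp /= expR0 cospi sinpi.
(* An argument equal to pi would mean [b / a = -1]. *)
have -> : -1 +i* 0 = -1 :> R[i] by apply/eqP; rewrite eq_complex /= oppr0 !eqxx.
by rewrite !mul1r mulN1r opprK.
Qed.

Lemma viro_addC (R : realType) (a b : R[i]) :
  viro_add a b `<=` viro_add b a.
Proof.
move=> c [[ab ->]|[ba ->]|[nab ab [al [be [ph [aE bE pi1 ph1 cE]]]]]|[ab0 ca]].
- by apply: Or42.
- by apply: Or41.
- apply: Or43; split=> //; first by rewrite eq_sym eqr_oppLR.
  exists be, al, ph; rewrite -nab; split=> //; first by rewrite distrC.
  by rewrite (distrC be ph) (distrC ph al) (distrC be al) addrC.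
- apply: Or44; rewrite addrC; split=> //.
  by move/eqP: ab0; rewrite addr_eq0 => /eqP aE; rewrite aE normrN in ca.
Qed.

Lemma cle_total (R : realType) (z w : R[i]) : cle z w || cle w z.
Proof.
case: z w => [a b] [c d]; rewrite /cle /Cplus /= !subr_ge0 !subr_eq0.
by have [//|//|_] := ltgtP a c; rewrite /= le_total.
Qed.

(** A strict inequality between exponents may become an equality of moduli, when
    only the imaginary parts differ; hence the appeal to [viro_add_maxl], which
    asks for a weak inequality. *)
Lemma ev_add (R : realType) (x y : Cflat R) :
  @ev R @` Cflat_add x y `<=` viro_add (ev x) (ev y).
Proof.
have evl (u v : Cflat R) : `|ev v| <= `|ev u| -> viro_add (ev u) (ev v) (ev u).
  exact: viro_add_maxl.
have evr (u v : Cflat R) : `|ev u| <= `|ev v| -> viro_add (ev u) (ev v) (ev v).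
  by move=> uv; apply/viro_addC/viro_add_maxl.
move=> _ [v + <-]; case: x y => [[s z]|] [[t w]|]; rewrite /Cflat_add.
- case: ifPn => [/andP[_ wz] ->|nwz]; first exact/evl/norm_ev_le.
  case: ifPn => [/andP[_ zw] ->|nzw]; first exact/evr/norm_ev_le.
  (* Neither exponent is strictly larger, so they agree by totality. *)
  have zw : z = w.
    move: nwz nzw; rewrite /clt; case: eqVneq => [->//|zw] /=.
    by move=> /negbTE wz /negbTE; have := cle_total z w; rewrite wz orbF => ->.
  subst w; case: eqP => [-> ->|st]; first by apply/evl.
  move=> vz; apply: Or44; split.
    have -> : t = ~~ s by case: s t st {vz} => [] [].
    by rewrite /= signrN mulNr subrr.
  case: vz => [->|[t' [z' [-> z'z]]]].
    by rewrite normr0.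
  exact: (norm_ev_le t' s).
- by move=> ->; apply: evl; rewrite normr0.
- by move=> ->; apply: evr; rewrite normr0.
- by move=> ->; apply: evl.
Qed.

(** * Surjectivity and kernel *)

(** Polar coordinates provide a logarithm, so the sign +1 already reaches every
    nonzero value. *)
Lemma ev_surj (R : realType) (z : R[i]) : z != 0 ->
  exists w : R[i], ev (signed_e false w) = z.
Proof.
move=> z0; have [t [_ zE]] := polar_form z0.
have nE : `|z| = (complex.Re `|z|)%:C by rewrite normc_def.
exists (ln (complex.Re `|z|) +i* t); rewrite /= mul1r [RHS]zE nE /cexp.
rewrite [complex.Re (_ +i* _)]/= [complex.Im (_ +i* _)]/= lnK ?posrE.
  by rewrite /= expR0 mul1r.
by move: z0; rewrite -normr_gt0 nE ltcR.
Qed.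

(** The sign of the power is left unspecified: in [ker_ev_units] the exponent is
    adjusted first, and the sign is then determined by the evaluation. *)
Lemma zpow_unit_e (R : realType) (s : bool) (z : R[i]) (n : int) :
  exists t : bool, zpow (unit_e s z) n = unit_e t (n%:~R * z).
Proof.
have pow (k : nat) : exists t, (unit_e s z ^+ k)%g = unit_e t (k%:R * z).
  elim: k => [|k [t IH]].
    by exists false; apply: val_inj; rewrite /= mul0r.
  exists (s (+) t); rewrite expgS IH; apply: val_inj => /=.
  by rewrite -add1n natrD mulrDl mul1r.
case: n => k /=; first exact: pow.
have [t ->] := pow k.+1; exists t; apply: val_inj => /=.
by rewrite NegzE mulrNz mulNr.
Qed.

Lemma ev_units_mul (R : realType) : {morph @ev_units R : x y / (x * y)%g}.
Proof. by move=> x y; apply: val_inj; exact: ev_mul. Qed.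

Lemma morph_zpow_ker (G H : groupType) (f : G -> H) (g : G) (n : int) :
  {morph f : x y / (x * y)%g} -> f g = 1%g -> f (zpow g n) = 1%g.
Proof.
move=> fM g1; have f1 : f 1%g = 1%g.
  by apply: (mulgI (f 1%g)); rewrite -fM !mulg1.
have pow (k : nat) : f (g ^+ k)%g = 1%g.
  by elim: k => [//|k IH]; rewrite expgS fM g1 IH mulg1.
case: n => k /=; first exact: pow.
by have := fM (g ^+ k.+1)%g (g ^- k.+1)%g; rewrite mulgV pow mul1g f1.
Qed.

Lemma ev_units_generator (R : realType) :
  ev_units (unit_e true (Complex 0 pi : R[i])) = 1%g.
Proof.
apply: val_inj; rewrite /= /cexp /= expR0 cospi sinpi.
by apply/eqP; rewrite eq_complex /=; apply/andP; split; apply/eqP; ring.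
Qed.

(** On the strip the sine of the imaginary part vanishes only at 0. The width pi,
    half the period, is the right one because translation by [i pi] can be
    compensated by a change of sign. *)
Lemma ker_ev_units_strip (R : realType) (s : bool) (z : R[i]) :
  0 <= complex.Im z < pi -> ev_units (unit_e s z) = 1%g -> unit_e s z = 1%g.
Proof.
move=> /andP[]; case: z => a b /= b0 bpi ker1.
have /(congr1 val) /= ev1 := ker1.
have a0 : a = 0.
  have := norm_ev_signed_e s (a +i* b); rewrite /= ev1 normr1.
  by move=> /(congr1 (@complex.Re R))/= /esym aE; rewrite -(expRK a) aE ln1.
move: ev1; rewrite a0 /cexp /= expR0 mul1r.
have -> : (-1) ^+ s = ((-1) ^+ s : R)%:C :> R[i] by rewrite rmorphXn rmorphN1.
move/eqP; rewrite eq_complex /= !mul0r subr0 addr0 => /andP[/eqP cos1].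
rewrite mulf_eq0 signr_eq0 /= => /eqP sinb.
have bE : b = 0.
  apply: contraTeq isT => bn0; have : 0 < sin b.
    by apply: sin_gt0_pi; rewrite lt_neqAle eq_sym bn0 b0.
  by rewrite sinb ltxx.
subst a b; case: s cos1 {ker1} => [|_]; last exact: val_inj.
by rewrite cos0 mulr1 expr1 => N11; exfalso; lra.
Qed.

(** Division by the n-th power of the generator, with n the floor of [Im z / pi],
    moves the element into the strip of [ker_ev_units_strip]. *)
Lemma ker_ev_units (R : realType) (x : Cflat_units R) :
  ev_units x = 1%g <->
  exists n : int, x = zpow (unit_e true (Complex 0 pi : R[i])) n.
Proof.
split=> [x1|[n ->]]; last by apply: morph_zpow_ker; [exact: ev_units_mul|exact: ev_units_generator].
case: x x1 => -[[s [a b]]|//] x0.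
have -> : exist _ (Some (s, a +i* b)) x0 = unit_e s (a +i* b) by exact: val_inj.
move=> x1; pose n := Num.floor (b / pi); exists n.
set g := unit_e true _.
have [t gn] := @zpow_unit_e R true (0 +i* pi) n.
have xgE : (unit_e s (a +i* b) / zpow g n)%g =
    unit_e (s (+) t) (a +i* (b - n%:~R * pi)).
  rewrite gn; apply: val_inj => /=; congr signed_e.
  rewrite -(rmorph_int (real_complex R)).
  by apply/eqP; rewrite eq_complex /= !mul0r mulr0 subrr subr0 addr0 !eqxx.
apply: divg1_eq; rewrite xgE; apply: ker_ev_units_strip; last first.
  have g1 := morph_zpow_ker n (@ev_units_mul R) (ev_units_generator R).
  by rewrite -xgE -[LHS]mulg1 -g1 -ev_units_mul mulgVK x1 g1.
have /andP[] := floor_itv (b / pi).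
rewrite ler_pdivlMr ?pi_gt0// ltr_pdivrMr ?pi_gt0// -/n => n1 n2 /=.
by rewrite subr_ge0 n1 ltrBlDl; rewrite intrD mulrDl mul1r in n2.
Qed.

Theorem proposition7p8 (R : realType) :
  (hyperfield_hom (H := Cflat_ops R) (K := TC_ops R) (@ev R) /\
   forall x : Cflat R, ev x = Cflat_seq x 0) /\
  (range (@ev R) = [set: R[i]] /\
   short_exact
     (val : powers_group (unit_e true (Complex 0 pi : R[i])) -> Cflat_units R)
     (@ev_units R)).
Proof.
split; split.
- split=> //.
  + by rewrite /= cexp0 mul1r.
  + exact: ev_mul.
  + exact: ev_add.
- by case=> [[s z]|]//=; rewrite expr0z mul1r.
- apply/seteqP; split=> // z _; have [->|z0] := eqVneq z 0.
    by exists Cflat0.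
  by have [w <-] := ev_surj z0; exists (signed_e false w).
- split.
  + by split; [|exact: ev_units_mul].
  + exact: val_inj.
  + apply/seteqP; split=> [_ [[x /asboolP xg] _ <-]|x /ker_ev_units xg] /=.
      exact/ker_ev_units.
    have xP : x \in powers (unit_e true (Complex 0 pi : R[i])).
      exact/asboolP.
    by exists (exist _ x xP).
  + apply/seteqP; split=> // -[z z0] _; have [w wE] := ev_surj z0.
    by exists (unit_e false w) => //; apply: val_inj.
Qed.
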